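(* Let $\delta>0$, let $\mu$ be a probability distribution on $\mathbb{R}$, and let $n\ge 1$ be an integer. Then any $n$-sample randomized estimator $\widetilde{e}$ satisfies $Q(\widetilde{e})\le T_{\mu,n}$.
   Context: For $\theta\in\mathbb{R}$, $\mu_\theta(A)=\mu(\{x:x+\theta\in A\})$, and $\mu_\theta^n$ is the product measure on $\mathbb{R}^n$ (with $\mu^n=\mu_0^n$). An $n$-sample estimator is a (Borel) measurable function $e:\mathbb{R}^n\to\mathbb{R}$. An $n$-sample randomized estimator is a (jointly measurable) function $\widetilde{e}:\mathbb{R}^n\times\Omega\to\mathbb{R}$, where $\Omega$ is a probability space; thus for each fixed $\omega\in\Omega$, $\widetilde{e}(\cdot,\omega)$ is an estimator. Its ($\delta$-)quality is $Q(\widetilde{e})=\inf_{\theta\in\mathbb{R}}Q^\theta(\widetilde{e})$, where $Q^\theta(\widetilde{e})=\mathbb{E}_{\omega}\,\mu_\theta^n(\{\mathbf{x}\in\mathbb{R}^n:|\widetilde{e}(\mathbf{x},\omega)-\theta|<\delta\})$. For $B\subset\mathbb{R}^n$ and $t\in\mathbb{R}$, $B+t=\{(x_1+t,\ldots,x_n+t):(x_1,\ldots,x_n)\in B\}$. Let $\mathcal{B}$ be the collection of all Borel sets $B\subset\mathbb{R}^n$ such that $B\cap(B+2k\delta)=\emptyset$ for all nonzero integers $k$, and define $T_{\mu,n}=T_{\mu,n}(\delta)=\sup_{B\in\mathcal{B}}\mu^n(B)$. *)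

(* Defs.v *)
From HB Require Import structures.
From mathcomp Require Import all_boot all_order all_algebra.
From mathcomp Require Import all_classical all_reals all_analysis.
From mathcomp Require Import measurable_realfun.

Set Implicit Arguments.
Unset Strict Implicit.
Unset Printing Implicit Defensive.

Import Order.TTheory GRing.Theory Num.Theory.
Import numFieldNormedType.Exports.

Local Open Scope classical_set_scope.
Local Open Scope ring_scope.

Section ProductProbability.
Context d (T : measurableType d) (R : realType).

Definition cons_pair n (p : T * n.-tuple T) : n.+1.-tuple T :=
  [tuple of p.1 :: p.2].

Lemma measurable_cons_pair n : measurable_fun setT (@cons_pair n).
Proof. exact: (measurable_cons measurable_fst measurable_snd). Qed.

HB.instance Definition _ n :=
  isMeasurableFun.Build _ _ _ _ (@cons_pair n) (@measurable_cons_pair n).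

(* n.-tuple T carries the sigma-algebra generated by the coordinate projections;
   for T = R this is the Borel sigma-algebra of R^n.  prod_prob P n is the n-fold
   power of P, obtained by iterating the binary product; prod_probE gives its
   values on boxes, which determine it. *)
Fixpoint prod_prob (P : probability T R) n : probability (n.-tuple T) R :=
  match n with
  | 0 => \d_([tuple] : 0.-tuple T)
  | m.+1 => distribution (P \x prod_prob P m)%E (@cons_pair m)
  end.

Lemma prod_probE (P : probability T R) n (A : 'I_n -> set T) :
  (forall i, measurable (A i)) ->
  prod_prob P n [set x | forall i, A i (tnth x i)] = (\prod_(i < n) P (A i))%E.
Proof.
elim: n A => [|n IH] A mA.
  rewrite big_ord0 /= diracE; suff -> : ([tuple] : 0.-tuple T) \in
    [set x | forall i, A i (tnth x i)] by [].
  by rewrite inE => -[].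
rewrite big_ord_recl -IH // /= /distribution /pushforward.
rewrite -product_measure1E //; last first.
  rewrite (_ : mkset _ =
      \big[setI/setT]_(i < n) ((@tnth _ T ^~ i) @^-1` A (lift ord0 i))).
    apply: bigsetI_measurable => i _; rewrite -[X in measurable X]setTI.
    exact: measurable_tnth.
  rewrite -bigcap_seq; apply/seteqP.
  split => [x xA i _|x xA i]; first exact: xA.
  by apply: xA; rewrite /= mem_index_enum.
congr (_ _); apply/seteqP; split => -[a x] /=.
  move=> xA; split; first by have := xA ord0.
  by move=> i; have := xA (lift ord0 i); rewrite tnthS.
move=> [Aa xA] i; case: (unliftP ord0 i) => [j ->|->] //.
by rewrite tnthS.
Qed.

End ProductProbability.

Section Estimation.
Context {R : realType}.
Implicit Types (mu : probability R R) (theta delta : R) (n : nat).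

Lemma measurable_shift theta : measurable_fun [set: R] (shift theta).
Proof.
exact: measurable_funD.
Qed.

HB.instance Definition _ theta :=
  isMeasurableFun.Build _ _ _ _ (shift theta : R -> R) (measurable_shift theta).

Definition translate mu theta : probability R R :=
  distribution mu (shift theta).

(* Measurability is joint, so each section e (_, w) is Borel. *)
Definition randomized_estimator n dO (Omega : measurableType dO) :=
  {mfun (n.-tuple R * Omega)%type >-> R}.

Definition quality_at delta mu n dO (Omega : measurableType dO)
    (P : probability Omega R) (e : randomized_estimator n Omega) theta
    : \bar R :=
  (\int[P]_w prod_prob (translate mu theta) n
     [set x : n.-tuple R | (`|e (x, w) - theta| < delta)%R])%E.

Definition quality delta mu n dO (Omega : measurableType dO)
    (P : probability Omega R) (e : randomized_estimator n Omega) : \bar R :=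
  ereal_inf [set quality_at delta mu P e theta | theta in [set: R]].

Definition diag_shift n (B : set (n.-tuple R)) (t : R) : set (n.-tuple R) :=
  [set map_tuple (shift t) x | x in B].

Definition shift_disjoint delta n : set (set (n.-tuple R)) :=
  [set B | measurable B /\
    forall k : int, k != 0 -> B `&` diag_shift B (2 * k%:~R * delta) = set0].

Definition T_mu mu n delta : \bar R :=
  ereal_sup [set prod_prob mu n B | B in @shift_disjoint delta n].

End Estimation.

(* Main.v *)
Require Import Defs.
From mathcomp Require Import all_boot all_order all_algebra.
From mathcomp Require Import all_classical all_reals all_analysis.
From mathcomp Require Import measurable_realfun ring lra zify.

(** Consider the parameters theta_k = 2 k delta, for k an integer.  The events
    that e(x) is within delta of theta_k are pairwise disjoint in k, but to
    compare their probabilities, each under its own translated measure, they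
    have to be moved back to mu^n (lemma prod_prob_translate), giving the sets
    hit k = {x : |e(x + theta_k) - theta_k| < delta}, which may overlap.  The proof covers them by sets of the collection in the
    definition of T.

    Fix one coordinate and let j(x) be the index of the cell,
    2 j delta <= . < 2 (j + 1) delta, containing this coordinate of x, so that
    j(x + theta_k) = j(x) + k.  For every integer m the formula
      e_m(x) = e(x + theta_(m - j(x))) - theta_(m - j(x))
    defines an estimator that commutes with translations by multiples of
    2 delta.  Hence recentred m = {x : |e_m(x)| < delta} is disjoint from its
    translates by nonzero multiples of 2 delta, and its mass is at most T
    (lemma recentred_shift_disjoint).  Moreover x lies in hit k if and only if
    it lies in recentred (j(x) + k).

    Restrict x to the window where -J <= j(x) < J, whose complement has mass at
    most eps once J is large (lemma window_tail).  For 0 <= k < N only N + 2J values of m = j + k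
    occur, and a given x and m determine k.  Therefore
      sum_(k < N) mu^n(hit k) <= (N + 2J) T + N eps        (lemma sum_hit_le).
    For a randomized estimator this holds for each omega, and integrating over
    omega bounds N Q (lemma sum_quality_le).  Divide by N, let N tend to
    infinity with J fixed, and then let eps tend to 0. *)

Set Implicit Arguments.
Unset Strict Implicit.
Unset Printing Implicit Defensive.

Import Order.TTheory GRing.Theory Num.Theory.
Local Open Scope ring_scope.
Local Open Scope classical_set_scope.

(** * Products of translated measures *)

Lemma measurable_map_shift (R : realType) n (t : R) :
  measurable_fun [set: n.-tuple R] (fun x : n.-tuple R => map_tuple (shift t) x).
Proof.
apply/measurable_fun_tnthP => i.
rewrite (_ : _ \o _ = shift t \o (fun x : n.-tuple R => tnth x i)).
  apply: measurableT_comp; first exact: measurable_shift.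
  exact: measurable_tnth.
by apply/funext => x /=; rewrite tnth_map.
Qed.

Lemma measurable_preimage_map_shift (R : realType) n (t : R)
    (A : set (n.-tuple R)) :
  measurable A -> measurable [set x : n.-tuple R | A (map_tuple (shift t) x)].
Proof.
by move=> mA; rewrite -[X in measurable X]setTI; exact: measurable_map_shift.
Qed.

Lemma map_shiftD (R : realType) n (s t : R) (x : n.-tuple R) :
  map_tuple (shift s) (map_tuple (shift t) x) = map_tuple (shift (t + s)) x.
Proof. by apply: eq_from_tnth => i; rewrite !tnth_map /= addrA. Qed.

(** The measure [prod_prob] is an iterated pushforward of binary products, so by
    Fubini a set is measured by integrating the measure of its sections over the
    first coordinate; the translation is then removed from the sections by
    induction and from the first coordinate by change of variables. *)
Lemma prod_prob_translate (R : realType) (mu : probability R R) (t : R) n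
    (A : set (n.-tuple R)) : measurable A ->
  prod_prob (translate mu t) n A =
  prod_prob mu n [set x | A (map_tuple (shift t) x)].
Proof.
elim: n A => [|n IH] A mA.
  congr (prod_prob mu 0 _); apply/funext => x.
  by rewrite /mkset; congr (A _); apply: eq_from_tnth => -[].
have consE (B : set (n.+1.-tuple R)) (P : probability R R) :
    measurable B -> prod_prob P n.+1 B =
    (\int[P]_x prod_prob P n [set y | B (cons_pair (x, y))])%E.
  move=> mB; transitivity
    (\int[P]_x prod_prob P n (xsection (@cons_pair _ R n @^-1` B) x))%E.
    by [].
  apply: eq_integral => x _; congr (prod_prob P n _).
  by apply/seteqP; split => y; rewrite /xsection /= ?inE.
have mcons (B : set (n.+1.-tuple R)) : measurable B ->
    measurable (@cons_pair _ R n @^-1` B).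
  by move=> mB; rewrite -[X in measurable X]setTI; exact: measurable_cons_pair.
have msec (B : set (n.+1.-tuple R)) x : measurable B ->
    measurable [set y | B (cons_pair (x, y))].
  move=> mB; rewrite (_ : mkset _ = xsection (@cons_pair _ R n @^-1` B) x).
    exact: measurable_xsection (mcons _ mB).
  by apply/seteqP; split => y; rewrite /xsection /= ?inE.
rewrite !consE//; last exact: measurable_preimage_map_shift.
transitivity (\int[translate mu t]_x
    prod_prob mu n [set y | A (cons_pair (x, map_tuple (shift t) y))])%E.
  by apply: eq_integral => x _; rewrite IH//; exact: msec.
rewrite ge0_integral_distribution //; last first.
  (* Reading the induction hypothesis backwards turns the integrand into the
     measure of a section, whose measurability is known. *)
  have -> : (fun x => prod_prob mu n
      [set y | A (cons_pair (x, map_tuple (shift t) y))]) =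
      prod_prob (translate mu t) n \o xsection (@cons_pair _ R n @^-1` A).
    apply/funext => x /=; rewrite IH; last first.
      exact: measurable_xsection (mcons _ mA).
    by congr (prod_prob mu n _); apply/seteqP; split => y;
      rewrite /xsection /= ?inE.
  exact: measurable_fun_xsection (mcons _ mA).
apply: eq_integral => x _ /=; congr (prod_prob mu n _).
apply/seteqP; split => y /=; congr A; exact: val_inj.
Qed.

(** * Sets disjoint from their period translates, built from an estimator *)

(** With m = j + k, the index pairs (j, k) with j < M and k < N all lie on the
    diagonals m < N + M.  The offset J only relabels the first argument. *)
Lemma sum_diagonal_le (R : realType) (a : int -> int -> \bar R) (N J M : nat) :
  (forall j k, 0 <= a j k)%E ->
  (\sum_(0 <= k < N) \sum_(0 <= j < M) a (j%:Z - J%:Z)%R k%:Z <=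
   \sum_(0 <= m < N + M) \sum_(0 <= j < M) a (j%:Z - J%:Z)%R (m%:Z - j%:Z)%R)%E.
Proof.
move=> a0; rewrite exchange_big_nat [leRHS]exchange_big_nat /=.
rewrite big_nat [leRHS]big_nat; apply: lee_sum => j /andP[_ jM].
rewrite [leRHS](@big_cat_nat _ _ _ j) /=; [|lia|lia].
rewrite [X in (_ <= _ + X)%E](@big_cat_nat _ _ _ (N + j)) /=; [|lia|lia].
have -> : (\sum_(j <= m < N + j) a (j%:Z - J%:Z)%R (m%:Z - j%:Z)%R =
    \sum_(0 <= k < N) a (j%:Z - J%:Z)%R k%:Z)%E.
  rewrite -{1}[j]add0n big_addn addnK; apply: eq_bigr => k _.
  by congr (a _ _); lia.
by rewrite addeCA leeDl // adde_ge0 // sume_ge0.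
Qed.

Section Rounding.
Context {R : realType} {n : nat}.
Variables (delta : R) (i0 : 'I_n) (f : n.-tuple R -> R).
Hypotheses (delta_gt0 : 0 < delta) (mf : measurable_fun setT f).

(** The event that the estimator is correct at the parameter 2 k delta, moved
    back to the untranslated measure. *)
Definition hit (k : int) : set (n.-tuple R) :=
  [set x | `|f (map_tuple (shift (2 * k%:~R * delta)) x) - 2 * k%:~R * delta|
           < delta].

Definition cell (j : int) : set (n.-tuple R) :=
  [set x | j%:~R <= tnth x i0 / (2 * delta) < (j + 1)%:~R].

Definition window (J : nat) : set (n.-tuple R) :=
  [set x | - J%:R <= tnth x i0 / (2 * delta) < J%:R].

(** The success set |e_m| < delta of the estimator e_m that commutes with
    translations by 2 delta and equals f(x + 2 m delta) - 2 m delta on cell 0.  The union over cells makes measurability immediate. *)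
Definition recentred (m : int) : set (n.-tuple R) :=
  \bigcup_j (cell j `&` hit (m - j)).

Lemma measurable_hit k : measurable (hit k).
Proof.
have mA : measurable [set y | `|f y - 2 * k%:~R * delta| < delta].
  have mg : measurable_fun setT (fun y => `|f y - 2 * k%:~R * delta|).
    apply: measurableT_comp => //; apply: measurable_funB => //.
  rewrite (_ : mkset _ = setT `&` (fun y => `|f y - 2 * k%:~R * delta|) @^-1`
      [set` `]-oo, delta[%R]).
    exact: mg.
  by rewrite setTI; apply/seteqP; split => y; rewrite /= in_itv.
exact: (@measurable_preimage_map_shift _ _ _ _ mA).
Qed.

Lemma measurable_slab (a b : R) :
  measurable [set x : n.-tuple R | a <= tnth x i0 / (2 * delta) < b].
Proof.
have mg : measurable_fun setT (fun x : n.-tuple R => tnth x i0 / (2 * delta)).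
  by apply: measurable_funM => //; exact: measurable_tnth.
rewrite (_ : mkset _ = setT `&`
    (fun x : n.-tuple R => tnth x i0 / (2 * delta)) @^-1` [set` `[a, b[%R]).
  exact: mg.
by rewrite setTI; apply/seteqP; split => y; rewrite /= in_itv.
Qed.

Lemma measurable_recentred m : measurable (recentred m).
Proof.
apply: countable_bigcupT_measurable => // j.
by apply: measurableI; [exact: measurable_slab|exact: measurable_hit].
Qed.

Lemma cell_floor j x : cell j x <-> Num.floor (tnth x i0 / (2 * delta)) = j.
Proof.
split; first by move=> ?; apply/eqP; rewrite floor_eq.
by move=> <-; exact: floor_itv.
Qed.

Lemma tnth_shift_period k x :
  tnth (map_tuple (shift (2 * k%:~R * delta)) x) i0 / (2 * delta) =
  tnth x i0 / (2 * delta) + k%:~R.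
Proof.
rewrite tnth_map /= mulrDl; congr (_ + _).
by field; rewrite gt_eqF.
Qed.

(** If y and y + 2 k delta both belonged to the set, the same value z of f would
    be within delta of two points at distance 2 |k| delta: the cell index grows
    by k, which cancels the shift inside f. *)
Lemma recentred_shift_disjoint m : shift_disjoint delta (recentred m).
Proof.
split; first exact: measurable_recentred.
move=> k k0; apply/seteqP; split => // x [] [j _ [cx hx]] [y [j' _ [cy hy]]] yx.
have jE : j = j' + k.
  move: cx cy => /cell_floor + /cell_floor <-.
  by rewrite -yx tnth_shift_period floorDrz ?intr_int// intrKfloor => <-.
move: hx; rewrite -{}yx /hit /= map_shiftD.
have -> : 2 * k%:~R * delta + 2 * (m - j)%:~R * delta = 2 * (m - j')%:~R * delta.
  by rewrite jE; rewrite !rmorphB !rmorphD /=; lra.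
move: hy; rewrite /hit /=.
set z := f _ => hy hx.
have : `|2 * k%:~R * delta| < 2 * delta.
  have -> : 2 * k%:~R * delta = (z - 2 * (m - j)%:~R * delta) -
      (z - 2 * (m - j')%:~R * delta).
    by rewrite jE !rmorphB !rmorphD /=; lra.
  by rewrite (le_lt_trans (ler_normB _ _))// [ltRHS](_ : _ = delta + delta) ?ltrD//; lra.
rewrite mulrAC normrM ger0_norm ?mulr_ge0 ?ltW//.
rewrite gtr_pMr ?mulr_gt0// -intr_norm.
rewrite -[1]/(1%:~R) ltr_int.
by move: k0; rewrite -normr_gt0; lia.
Qed.

Lemma window_sub_cells J :
  window J `<=` \big[setU/set0]_(j < J.*2) cell (j%:Z - J%:Z).
Proof.
move=> x /andP[lo hi].
rewrite -(bigcup_mkord _ (fun j : nat => cell (j%:Z - J%:Z))).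
have /andP[lo' hi'] : - J%:Z <= Num.floor (tnth x i0 / (2 * delta)) < J%:Z.
  by rewrite floor_ge_int floor_lt_int rmorphN /= lo hi.
exists (absz (Num.floor (tnth x i0 / (2 * delta)) + J%:Z)) => /=.
  by lia.
by apply/cell_floor; lia.
Qed.

Lemma trivIset_cell J : trivIset setT (fun j : nat => cell (j%:Z - J%:Z)).
Proof.
by move=> i j _ _ [x [/cell_floor xi /cell_floor xj]]; lia.
Qed.

(** For fixed m the sets [cell j `&` hit (m - j)] are pairwise disjoint and lie in
    [recentred m], whence the bound t for each of the N + 2J diagonals; the
    points outside the window cost at most eps for each k. *)
Lemma sum_hit_le (nu : probability (n.-tuple R) R) (t eps : R) (N J : nat) :
  (forall B, shift_disjoint delta B -> nu B <= t%:E)%E ->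
  (nu (~` window J) <= eps%:E)%E ->
  (\sum_(0 <= k < N) nu (hit k%:Z) <= (t *+ (N + J.*2) + eps *+ N)%R%:E)%E.
Proof.
move=> nut nueps.
have mcell j : measurable (cell j) by exact: measurable_slab.
have mwin : measurable (window J) by exact: measurable_slab.
have hitk k : (nu (hit k) <=
    \sum_(0 <= j < J.*2) nu (cell (j%:Z - J%:Z)%R `&` hit k) + eps%:E)%E.
  rewrite [X in (nu X <= _)%E](_ : hit k =
      hit k `&` window J `|` hit k `&` ~` window J); last first.
    by rewrite -setIUr setUv setIT.
  have mh := measurable_hit k.
  have mhw : measurable (hit k `&` window J) by exact: measurableI.
  have mhwC : measurable (hit k `&` ~` window J).
    by apply: measurableI => //; exact: measurableC.
  apply: (le_trans (measureU2 _ mhw mhwC)).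
  apply: leeD; last first.
    apply: le_trans nueps; apply: le_measure; rewrite ?inE//.
    exact: measurableC.
  have mF (j : nat) : (j < J.*2)%N ->
      measurable (cell (j%:Z - J%:Z) `&` hit k).
    by move=> _; exact: measurableI.
  rewrite big_mkord; apply: le_trans (Boole_inequality nu mF).
  apply: le_measure; rewrite ?inE//.
    by apply: bigsetU_measurable => i _; exact: measurableI.
  move=> x [hx /window_sub_cells].
  rewrite -(bigcup_mkord _ (fun j : nat => cell (j%:Z - J%:Z))).
  rewrite -(bigcup_mkord _ (fun j : nat => cell (j%:Z - J%:Z) `&` hit k)).
  by case=> j jJ cx; exists j.
apply: (@le_trans _ _ (\sum_(0 <= k < N)
    (\sum_(0 <= j < J.*2) nu (cell (j%:Z - J%:Z)%R `&` hit k%:Z) + eps%:E))%E).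
  exact: lee_sum.
rewrite big_split /= EFinD; apply: leeD; last first.
  by rewrite sumEFin sumr_const_nat subn0.
apply: (le_trans (@sum_diagonal_le R (fun j k => nu (cell j `&` hit k)) _ _ _ _)).
  by [].
rewrite -[X in t *+ X]subn0 -sumr_const_nat -sumEFin.
apply: lee_sum => m _.
pose F (j : nat) := cell (j%:Z - J%:Z) `&` hit (m%:Z - j%:Z).
have mF j : measurable (F j) by apply: measurableI => //; exact: measurable_hit.
have tF : trivIset setT F.
  by apply: trivIset_setIr; exact: trivIset_cell.
rewrite big_mkord -(measure_bigsetU _ mF tF).
apply: le_trans (nut _ (recentred_shift_disjoint (m%:Z - J%:Z))).
apply: le_measure; rewrite ?inE.
- exact: bigsetU_measurable.
- exact: measurable_recentred.
rewrite -bigcup_mkord => x [j _ [cx hx]]; exists (j%:Z - J%:Z) => //; split => //.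
by rewrite (_ : _ - _ = m%:Z - j%:Z)//; lia.
Qed.

Lemma window_tail (nu : probability (n.-tuple R) R) (eps : R) : 0 < eps ->
  exists J, (nu (~` window J) <= eps%:E)%E.
Proof.
move=> eps0.
have mwin J : measurable (window J) by exact: measurable_slab.
have cvg : (nu \o (fun J => ~` window J)) J @[J --> \oo] -->
    nu (\bigcap_J ~` window J).
  apply: nonincreasing_cvg_mu.
  - exact: (le_lt_trans (probability_le1 _ (measurableC (mwin _))) (ltry _)).
  - by move=> J; exact: measurableC.
  - by apply: bigcap_measurable => // J _; exact: measurableC.
  move=> J K JK; apply/subsetPset; apply: subsetC => x /andP[lo hi].
  have JKR : J%:R <= K%:R :> R by rewrite ler_nat.
  by apply/andP; split; lra.
have cap0 : \bigcap_J ~` window J = set0.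
  rewrite -setC_bigcup -setCT; congr (~` _); apply/seteqP; split => // x _.
  have : [set: R] (tnth x i0 / (2 * delta)) by [].
  rewrite -(bigcup_itvT true true) => -[J _]; rewrite /= in_itv /= => xJ.
  by exists J.
rewrite cap0 measure0 in cvg.
have [J _ /(_ J (leqnn J)) tailJ] :=
  cvg _ (@nbhs_open_ereal_lt _ 0 (fun=> eps) eps0).
by exists J; exact: ltW.
Qed.

End Rounding.

(** * Averaging over the randomization *)

Section AveragedQuality.
Context {R : realType} {n : nat} {dO : measure_display}.
Context {Omega : measurableType dO}.
Variables (delta : R) (mu : probability R R) (P : probability Omega R).
Variable e : @randomized_estimator R n dO Omega.

Let success (theta : R) : set (n.-tuple R * Omega) :=
  [set z | `|e z - theta| < delta].

Lemma measurable_success theta : measurable (success theta).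
Proof.
have mg : measurable_fun setT (fun z => `|e z - theta|).
  by apply: measurableT_comp => //; apply: measurable_funB => //.
rewrite (_ : success theta =
    setT `&` (fun z => `|e z - theta|) @^-1` [set` `]-oo, delta[%R]).
  exact: mg.
by rewrite setTI; apply/seteqP; split => y; rewrite /= in_itv.
Qed.

Lemma measurable_estimator_section w :
  measurable_fun setT (fun x : n.-tuple R => e (x, w)).
Proof. by apply: measurableT_comp => //; exact: measurable_pair2. Qed.

Lemma prod_prob_translate_hit (k : int) w :
  prod_prob (translate mu (2 * k%:~R * delta)) n
    [set x : n.-tuple R | `|e (x, w) - 2 * k%:~R * delta| < delta] =
  prod_prob mu n (hit delta (fun x => e (x, w)) k).
Proof.
rewrite prod_prob_translate// (_ : mkset _ =
    ysection (success (2 * k%:~R * delta)) w).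
  exact: measurable_ysection (measurable_success _).
by apply/seteqP; split => x; rewrite /ysection /= ?inE.
Qed.

Lemma measurable_prod_prob_success theta :
  measurable_fun setT (fun w => prod_prob (translate mu theta) n
    [set x : n.-tuple R | `|e (x, w) - theta| < delta]).
Proof.
rewrite (_ : (fun w => _) =
    prod_prob (translate mu theta) n \o ysection (success theta)).
  exact: measurable_fun_ysection (measurable_success _).
apply/funext => w /=; congr (prod_prob _ n _).
by apply/seteqP; split => x; rewrite /ysection /= ?inE.
Qed.

(** The infimum over all parameters is at most the average over the parameters
    2 k delta, and the bound on the sum of the success probabilities is uniform
    in w. *)
Lemma sum_quality_le (i0 : 'I_n) (t eps : R) (N J : nat) : 0 < delta ->
  (forall B, shift_disjoint delta B -> prod_prob mu n B <= t%:E)%E ->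
  (prod_prob mu n (~` window delta i0 J) <= eps%:E)%E ->
  (\sum_(0 <= k < N) quality delta mu P e <=
   (t *+ (N + J.*2) + eps *+ N)%R%:E)%E.
Proof.
move=> delta0 Bt tail.
apply: (@le_trans _ _ (\sum_(0 <= k < N)
    quality_at delta mu P e (2 * (k%:Z)%:~R * delta)))%E.
  apply: lee_sum => k _; apply: ereal_inf_lbound.
  by exists (2 * (k%:Z)%:~R * delta).
rewrite -ge0_integral_sum//; last first.
  by move=> k; exact: measurable_prod_prob_success.
rewrite -[leRHS]mule1 -(probability_setT P) -integral_cst//.
apply: ge0_le_integral => //.
- by move=> w _; exact: sume_ge0.
- apply: emeasurable_sum => k; exact: measurable_prod_prob_success.
move=> w _; under eq_bigr do rewrite prod_prob_translate_hit.
exact: (sum_hit_le delta0 (measurable_estimator_section w) N Bt tail).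
Qed.

End AveragedQuality.

Theorem theorem5 (R : realType) (delta : R) (hdelta : 0 < delta)
    (mu : probability R R) (n : nat) (hn : (1 <= n)%N)
    (dO : measure_display) (Omega : measurableType dO)
    (P : probability Omega R) (e : @randomized_estimator R n dO Omega) :
  (quality delta mu P e <= T_mu mu n delta)%E.
Proof.
pose i0 := Ordinal hn.
have BT B : shift_disjoint delta B -> (prod_prob mu n B <= T_mu mu n delta)%E.
  by move=> dB; apply: ereal_sup_ubound; exists B.
have T0 : (0 <= T_mu mu n delta)%E.
  rewrite -(measure0 (prod_prob mu n)); apply: BT.
  by split => // k _; rewrite set0I.
have T1 : (T_mu mu n delta <= 1)%E.
  by apply: ge_ereal_sup => _ [B [mB _] <-]; exact: probability_le1.
have [t tE] : exists t, T_mu mu n delta = t%:E.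
  by exists (fine (T_mu mu n delta)); rewrite fineK// fin_numElt
    (lt_le_trans (ltNyr 0) T0) (le_lt_trans T1 (ltry 1)).
rewrite tE in BT T0 *.
apply/lee_addgt0Pr => eps eps0.
have eps20 : 0 < eps / 2 by rewrite divr_gt0.
have [J tail] := window_tail delta i0 (prod_prob mu n) eps20.
have avg N := sum_quality_le P e N hdelta BT tail.
case: (quality delta mu P e) avg => [r| |] avg.
- rewrite -EFinD lee_fin.
  (* N is so large that the boundary term 2 J t is at most N eps / 2. *)
  pose N := (Num.bound (t *+ J.*2 / (eps / 2))).+1.
  have N0 : 0 < N%:R :> R by rewrite ltr0n.
  have NJ : t *+ J.*2 <= (eps / 2) *+ N.
    rewrite -[leRHS]mulr_natr mulrC -ler_pdivrMr//.
    have q0 : 0 <= t *+ J.*2 / (eps / 2).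
      by rewrite divr_ge0 ?mulrn_wge0// ?ltW// -lee_fin.
    by rewrite (le_trans (ltW (archi_boundP q0)))// ler_nat.
  have := avg N.
  rewrite sumEFin lee_fin sumr_const_nat subn0 => rN.
  rewrite -(ler_pM2r N0) !mulr_natr.
  apply: (le_trans rN).
  rewrite [in leRHS](splitr eps) !mulrnDl mulrnDr; lra.
(* The bound with N = 1 excludes an infinite quality. *)
- by have := avg 1%N; rewrite big_nat1.
- exact: leNye.
Qed.
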